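(* For every integer $n\ge 3$, the visibility polynomial of the cycle $C_n$ of order $n$ is $$\mathcal{V}(C_n)=1+nx+\binom{n}{2}x^2+r_3x^3,$$ where $$r_3=\begin{cases}\dfrac{n(n^2-1)}{24} & \text{if } n \text{ is odd},\\[8pt] \dfrac{(n-2)n(n+8)}{24} & \text{if } n \text{ is even}.\end{cases}$$
   Context: Graphs are finite, simple and undirected. For a graph $G=(V,E)$ and $X\subseteq V$, two vertices $u,v$ are $X$-visible if there is a shortest $(u,v)$-path $P$ in $G$ with $V(P)\cap X\subseteq\{u,v\}$. A set $X\subseteq V$ is a mutual-visibility set of $G$ if every pair of vertices in $X$ is $X$-visible (the empty set counts as a mutual-visibility set). The visibility polynomial of $G$ is $\mathcal{V}(G)=\sum_{i\ge 0} r_i x^i$, where $r_i$ is the number of mutual-visibility sets of $G$ of cardinality $i$. $C_n$ denotes the cycle graph on $n$ vertices. *)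

(* Defs.v *)
From HB Require Import structures.
From mathcomp Require Import all_boot all_order all_algebra.
From mathcomp Require Import boolp.

Set Implicit Arguments.
Unset Strict Implicit.
Unset Printing Implicit Defensive.

Import GRing.Theory.
Local Open Scope ring_scope.

Record sgraph := SGraph {
  vertex :> finType;
  edge : rel vertex;
  edge_sym : symmetric edge;
  edge_irrefl : irreflexive edge }.

Arguments edge {G} : rename.

Section MutualVisibility.
Variable G : sgraph.
Implicit Types (u v w : G) (p q : seq G) (X : {set G}).

(* The path with vertex sequence u :: p, of length size p. *)
Definition is_path u v p : bool :=
  [&& path edge u p, uniq (u :: p) & last u p == v].

Definition is_shortest_path u v p : Prop :=
  is_path u v p /\ forall q, is_path u v q -> (size p <= size q)%N.

Definition visible X u v : Prop :=
  exists p, is_shortest_path u v p /\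
    [set w in u :: p] :&: X \subset [set u; v].

Definition mutual_visibility_set X : Prop :=
  forall u v, u \in X -> v \in X -> visible X u v.

Definition num_mutual_visibility_sets (i : nat) : nat :=
  #|[set X : {set G} | `[< mutual_visibility_set X >] & #|X| == i]|.

(* No set of vertices has more than #|G| elements, so the sum stops there. *)
Definition visibility_poly : {poly rat} :=
  \sum_(i < #|G|.+1) (num_mutual_visibility_sets i)%:R *: 'X^i.

End MutualVisibility.

(* ordS is the successor modulo n; the condition i != j only matters for
   n = 1, where it excludes a loop. *)
Definition cycle_edge (n : nat) : rel 'I_n :=
  fun i j => (i != j) && ((j == ordS i) || (i == ordS j)).

Lemma cycle_edge_sym n : symmetric (@cycle_edge n).
Proof. by move=> i j; rewrite /cycle_edge eq_sym orbC. Qed.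

Lemma cycle_edge_irrefl n : irreflexive (@cycle_edge n).
Proof. by move=> i; rewrite /cycle_edge eqxx. Qed.

Definition cycle_graph (n : nat) : sgraph :=
  SGraph (@cycle_edge_sym n) (@cycle_edge_irrefl n).

(* Main.v *)
Require Import Defs.
From mathcomp Require Import all_boot all_order all_algebra.
From mathcomp Require Import boolp zify ring.

(** Orient the cycle and let [cdist u v] be the number of clockwise steps from
    [u] to [v].  Two facts govern visibility.  An arc of length at most half the
    cycle is a shortest path ([visible_arc]).  Conversely, cutting the cycle at
    a vertex [w] leaves a line with coordinate [cdist w], so a path that avoids
    [w] moves this coordinate by at most one per step: it is at least as long as
    the arc avoiding [w] ([walk_size_ge_avoiding]) and meets every vertex in
    between ([walk_sweeps]).

    Hence every set of at most two vertices is a mutual-visibility set.  No set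
    of four or more is one: for [b], [c], [e] in clockwise order after [a], a
    path from [a] to [c] has to pass through [b] or [e]
    ([mutual_visibility_lt4]).  A triple fails exactly when one of its three
    arcs is longer than half the cycle, since the only shortest path between the
    ends of that arc then runs through the third vertex; this is the discrete
    form of an inscribed triangle being obtuse ([mutual_visibility3]).

    The failing triples are counted by their apex, the vertex [u] from which the
    long arc starts clockwise: the two other vertices lie beyond half the cycle
    from [u].  An apex is unique and there are [n.-1./2] such vertices, any two
    of which will do, so there are [n * 'C(n.-1./2, 2)] failing triples among
    the ['C(n, 3)] triples.  The two cases of the theorem are the values of the
    difference for the two parities of [n]. *)

Import GRing.Theory.
Local Open Scope ring_scope.

(** * Shortest paths in a general graph *)

Section GeneralGraph.
Local Open Scope nat_scope.
Set Implicit Arguments.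
Unset Strict Implicit.
Variable G : sgraph.

Lemma is_path_rev (u v : G) p :
  is_path u v p -> exists q, [/\ is_path v u q, size q = size p &
    u :: p =i v :: q].
Proof.
case/and3P=> pp up /eqP lp.
have eq_rev : rev (u :: p) = v :: rev (belast u p).
  by rewrite lastI rev_rcons lp.
exists (rev (belast u p)); split.
- apply/and3P; split.
  + rewrite -lp rev_path.
    by rewrite (eq_path (e' := edge)) // => x y; rewrite /= edge_sym.
  + by rewrite -eq_rev rev_uniq.
  + case: p {pp up lp eq_rev} => [|x p] /= in lp *; first by rewrite lp.
    by rewrite rev_cons last_rcons.
- by rewrite size_rev size_belast.
- by move=> x; rewrite -eq_rev mem_rev.
Qed.

Lemma visible_sym (X : {set G}) (u v : G) : visible X u v -> visible X v u.
Proof.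
case=> p [[pP pmin] pX].
have [q [qP qsz pq]] := is_path_rev pP.
exists q; split; first split=> //.
  by move=> r /is_path_rev[r' [r'P <- _]]; rewrite qsz; apply: pmin.
apply/subsetP=> x; rewrite inE inE -pq => /andP[xp xX].
by rewrite setUC; apply: (subsetP pX); rewrite inE inE xp.
Qed.

Lemma visible_refl (X : {set G}) (u : G) : visible X u u.
Proof.
exists [::]; split; first by split; rewrite // /is_path /= eqxx.
by apply/subsetP=> x; rewrite !inE => /andP[->].
Qed.

End GeneralGraph.

Section Cycle.
Local Open Scope nat_scope.
Set Implicit Arguments.
Unset Strict Implicit.
Variable n : nat.
Hypothesis hn : 3 <= n.
Notation C := (cycle_graph n).
Implicit Types (u v w t x : 'I_n) (p q : seq 'I_n) (X Y : {set 'I_n}).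

(** * Clockwise distance *)

Definition cdist u v : nat := if u <= v then v - u else v + n - u.

Lemma val_ordS u : val (ordS u) = if u.+1 == n then 0 else u.+1.
Proof.
have un := ltn_ord u; rewrite /=; case: eqP => [->|ne]; first exact: modnn.
by rewrite modn_small //; lia.
Qed.

(** The definition of [cdist] as linear constraints, the form that linear
    arithmetic needs to decide the lemmas below. *)
Lemma cdistP u v : (u < n /\ v < n) /\
  (u <= v /\ cdist u v + u = v \/ v < u /\ cdist u v + u = v + n).
Proof.
by split; rewrite ?ltn_ord // /cdist; have := ltn_ord u; case: (leqP u v); lia.
Qed.

Lemma cdist_lt u v : cdist u v < n.
Proof. by have := cdistP u v; lia. Qed.

Lemma cdist_inj u : injective (cdist u).
Proof.
by move=> v w e; apply: ord_inj; have := cdistP u v; have := cdistP u w; lia.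
Qed.

Lemma cdistxx u : cdist u u = 0.
Proof. by rewrite /cdist leqnn subnn. Qed.

Lemma cdist_gt0 u v : u != v -> 0 < cdist u v.
Proof. by rewrite -(inj_eq (@cdist_inj u)) cdistxx eq_sym lt0n. Qed.

Lemma cdistC u v : u != v -> cdist u v + cdist v u = n.
Proof.
by rewrite -val_eqE /=; have := cdistP u v; have := cdistP v u; lia.
Qed.

Lemma cdist_cyclic u v w :
  0 < cdist u v < cdist u w -> cdist w v = cdist w u + cdist u v.
Proof.
have := cdistP u v; have := cdistP u w.
by have := cdistP w u; have := cdistP w v; lia.
Qed.

Lemma cdist_iter u k : k < n -> cdist u (iter k (@ordS n) u) = k.
Proof.
elim: k => [|k IH] kn; first exact: cdistxx.
have := IH (ltnW kn); rewrite iterS; set x := iter k _ u => dx.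
have := cdistP u x; have := cdistP u (ordS x); have := val_ordS x.
by case: eqP => /=; lia.
Qed.

(** The clockwise walk from [u] has the coordinates 0, 1, 2, ...  Uniqueness,
    membership and counting along an arc all reduce to [iota] this way. *)
Lemma cdist_traject u k :
  k <= n -> [seq cdist u x | x <- traject (@ordS n) u k] = iota 0 k.
Proof.
move=> kn; apply: (@eq_from_nth _ 0); rewrite size_map size_traject ?size_iota //.
move=> i ik; rewrite (nth_map u) ?size_traject // nth_traject // nth_iota //.
by rewrite cdist_iter //; apply: leq_trans kn.
Qed.

Lemma edge_ordS u : edge (u : C) (ordS u).
Proof.
rewrite /= /cycle_edge eqxx andbT -val_eqE val_ordS.
by case: (u.+1 =P n) => /=; lia.
Qed.

(** The coordinate [cdist w] jumps from 0 to [n - 1] only across the edge that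
    leaves [w] counterclockwise, which a step from [u != w] does not take. *)
Lemma edge_cdist_away w u x :
  edge (u : C) x -> u != w -> cdist w x <= (cdist w u).+1.
Proof.
rewrite /= /cycle_edge -!val_eqE !val_ordS /=.
have := cdistP w x; have := cdistP w u.
by case: (u.+1 =P n); case: (x.+1 =P n); lia.
Qed.

(** The minimum of the two arc lengths is the graph distance; this bound, iterated
    along a walk, shows that no walk is shorter. *)
Lemma edge_cdist_min v u x : edge (u : C) x ->
  minn (cdist u v) (cdist v u) <= (minn (cdist x v) (cdist v x)).+1.
Proof.
rewrite /= /cycle_edge -!val_eqE !val_ordS /=.
have := cdistP x v; have := cdistP u v.
have := cdistP v x; have := cdistP v u.
by case: (u.+1 =P n); case: (x.+1 =P n); lia.
Qed.

(** * Walks and arcs *)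

Lemma walk_size_ge_min u p : path edge (u : C) p ->
  minn (cdist u (last u p)) (cdist (last u p) u) <= size p.
Proof.
elim: p u => [|x p IH] u /=; first by rewrite cdistxx.
by case/andP=> ux /IH; have := edge_cdist_min (last x p) ux; lia.
Qed.

Lemma walk_size_ge_avoiding w u p : path edge (u : C) p -> w \notin u :: p ->
  cdist w (last u p) <= cdist w u + size p.
Proof.
elim: p u => [|x p IH] u /=; first by rewrite addn0.
case/andP=> ux xp; rewrite inE negb_or eq_sym => /andP[uw /(IH _ xp)].
have := edge_cdist_away ux uw; lia.
Qed.

(** A discrete intermediate value theorem on the line obtained by cutting the
    cycle at [w]. *)
Lemma walk_sweeps w t u p : path edge (u : C) p -> w \notin u :: p ->
  cdist w u <= cdist w t <= cdist w (last u p) -> t \in u :: p.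
Proof.
elim: p u => [|x p IH] u /=.
  by move=> _ _ tu; rewrite inE -(inj_eq (@cdist_inj w)); lia.
case/andP=> ux xp; rewrite inE negb_or eq_sym => /andP[uw wp] bt.
rewrite inE -(inj_eq (@cdist_inj w)); case: eqP => //= ne.
by apply: IH => //; have := edge_cdist_away ux uw; lia.
Qed.

Definition arc u v := traject (@ordS n) (ordS u) (cdist u v).

Lemma mem_arc u v w : w \in u :: arc u v -> cdist u w <= cdist u v.
Proof.
rewrite -trajectS => /(map_f (cdist u)).
by rewrite cdist_traject ?cdist_lt // mem_iota.
Qed.

Lemma size_arc u v : size (arc u v) = cdist u v.
Proof. exact: size_traject. Qed.

Lemma is_path_arc u v : is_path (u : C) v (arc u v).
Proof.
apply/and3P; split.
- apply: (@sub_path _ (frel (@ordS n))); last exact: fpath_traject.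
  by move=> x y /= /eqP <-; apply: edge_ordS.
- rewrite -trajectS; apply: (@map_uniq _ _ (cdist u)).
  by rewrite cdist_traject ?cdist_lt ?iota_uniq.
- rewrite /arc last_traject; apply/eqP/(@cdist_inj u).
  by rewrite cdist_iter ?cdist_lt.
Qed.

Lemma visible_arc X u v : 2 * cdist u v <= n ->
  (forall w, w \in X -> w != u -> w != v -> cdist u v < cdist u w) ->
  visible (G := C) X u v.
Proof.
move=> duv freeX; exists (arc u v); split; first split.
- exact: is_path_arc.
- move=> q /and3P[qp _ /eqP ql]; rewrite size_arc.
  apply: leq_trans (walk_size_ge_min qp); rewrite ql.
  case: (eqVneq u v) => [->|uv]; first by rewrite cdistxx.
  by have := cdistC uv; lia.
- apply/subsetP=> w; rewrite !inE => /andP[wp wX].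
  case: eqVneq => //= wu; case: eqVneq => //= wv.
  by have := freeX _ wX wu wv; have := mem_arc wp; lia.
Qed.

(** What visibility gives to the negative results: a path avoiding the rest of
    [X].  The bound on its size comes from the reversed arc from [v] to [u],
    which is a competing path. *)
Lemma visible_path_avoids X u v : visible (G := C) X u v ->
  exists p, [/\ path edge (u : C) p, last u p = v, size p <= cdist v u &
    forall w, w \in X -> w != u -> w != v -> w \notin u :: p].
Proof.
case=> p [[/and3P[pp _ /eqP pl] pmin] pX]; exists p; split=> //.
  have [q [qP qsz _]] := is_path_rev (is_path_arc v u).
  by have := pmin q qP; rewrite qsz size_arc.
move=> w wX wu wv; apply/negP=> wp.
have: w \in [set u; v] by apply: (subsetP pX); rewrite inE inE wp.
by rewrite !inE (negPf wu) (negPf wv).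
Qed.

(** * Mutual-visibility sets by cardinality *)

Lemma mutual_visibility_le2 X :
  #|X| <= 2 -> mutual_visibility_set (G := C) X.
Proof.
move=> X2 u v uX vX; have [<-|uv] := eqVneq u v; first exact: visible_refl.
have XE : [set u; v] = X.
  by apply/eqP; rewrite eqEcard cards2 uv X2 subUset !sub1set uX vX.
wlog duv : u v uX vX uv XE / 2 * cdist u v <= n.
  move=> H; case: (leqP (2 * cdist u v) n) => [|duv]; first exact: H.
  apply/visible_sym/H; rewrite // 1?eq_sym 1?setUC //.
  by have := cdistC uv; lia.
apply: visible_arc => // w; rewrite -XE !inE.
by case/orP=> /eqP->; rewrite eqxx.
Qed.

(** With [a] in [X], let [b] and [e] be the first and last vertices of [X] met
    clockwise from [a], and [c] a third one.  Cut at [e], the coordinate of [b]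
    lies between those of [a] and [c], so a path from [a] to [c] that avoids [e]
    meets [b]. *)
Lemma mutual_visibility_lt4 X :
  mutual_visibility_set (G := C) X -> #|X| < 4.
Proof.
move=> mvX; rewrite ltnNge; apply/negP => X4.
have [a aX] : exists a, a \in X by apply/card_gt0P; lia.
have X3 : 3 <= #|X :\ a| by move: X4; rewrite (cardsD1 a) aX.
have [b0 b0X] : exists b, b \in X :\ a by apply/card_gt0P; lia.
pose b := [arg min_(x < b0 | x \in X :\ a) cdist a x].
pose e := [arg max_(x > b0 | x \in X :\ a) cdist a x].
have [bX bmin] : b \in X :\ a /\ forall x, x \in X :\ a -> cdist a b <= cdist a x.
  by rewrite /b; case: arg_minnP.
have [eX emax] : e \in X :\ a /\ forall x, x \in X :\ a -> cdist a x <= cdist a e.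
  by rewrite /e; case: arg_maxnP.
have [c] : exists c, c \in (X :\ a) :\: [set b; e].
  apply/card_gt0P; rewrite cardsD subn_gt0.
  apply: leq_ltn_trans (subset_leq_card (subsetIr _ _)) _.
  by rewrite cards2; lia.
rewrite in_setD !inE negb_or => /andP[/andP[cb ce] /andP[ca cX]].
move: bX eX; rewrite !inE => /andP[ba bX] /andP[ea eX].
have bc : cdist a b < cdist a c.
  by rewrite ltn_neqAle (inj_eq (@cdist_inj a)) eq_sym cb bmin // !inE ca.
have ce' : cdist a c < cdist a e.
  by rewrite ltn_neqAle (inj_eq (@cdist_inj a)) ce emax // !inE ca.
have [p [pp pl _ pX]] := visible_path_avoids (mvX a c aX cX).
have e_p : e \notin a :: p by apply: pX; rewrite // eq_sym.
have b_p : b \notin a :: p by apply: pX; rewrite // eq_sym.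
case/negP: b_p; apply: (walk_sweeps (w := e)) => //; rewrite pl.
have ab := @cdist_gt0 a b; rewrite eq_sym in ab; have {}ab := ab ba.
by have := @cdist_cyclic a b e; have := @cdist_cyclic a c e; lia.
Qed.

Definition far u : {set 'I_n} := [set w | n < 2 * cdist u w].

(** If the two other vertices of a triple both lie in [far u], the clockwise arc
    from [u] to the nearer of them is longer than half the cycle. *)
Definition apex X u := (u \in X) && (X :\ u \subset far u).

(** From an apex [u], the nearer vertex [v] is invisible: a path avoiding the
    third vertex [w] is at least as long as the arc from [u] to [v], and the other
    arc is strictly shorter.  Without an apex, any two vertices can be named [u] and [v]
    so that the clockwise arc from [u] to [v] misses the third vertex; were this
    arc too long, [u] would be an apex. *)
Lemma mutual_visibility3 X : #|X| = 3 ->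
  mutual_visibility_set (G := C) X <-> ~ exists u, apex X u.
Proof.
move=> X3; split.
  move=> mvX [u /andP[uX ufar]].
  have: #|X :\ u| == 2 by move: X3; rewrite (cardsD1 u) uX add1n => -[->].
  case/cards2P=> v [w [vw XE]].
  wlog lt_vw : v w vw XE / cdist u v < cdist u w.
    move=> H; case: (ltngtP (cdist u v) (cdist u w)); first exact: H.
      by apply: H; rewrite 1?eq_sym 1?setUC.
    by move/cdist_inj/eqP; rewrite (negPf vw).
  have: v \in X :\ u by rewrite XE set21.
  have: w \in X :\ u by rewrite XE set22.
  move=> wXu vXu; have := subsetP ufar _ vXu; rewrite inE => uv_far.
  move: wXu vXu; rewrite !inE => /andP[wu wX] /andP[vu vX].
  have [p [pp pl psz pX]] := visible_path_avoids (mvX u v uX vX).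
  have uv : u != v by rewrite eq_sym.
  have wv : w != v by rewrite eq_sym.
  have := walk_size_ge_avoiding pp (pX w wX wu wv); rewrite pl.
  have := @cdist_cyclic u v w; have := cdistC uv; have := cdist_gt0 uv.
  by lia.
move=> noapex u v uX vX; have [<-|uv] := eqVneq u v; first exact: visible_refl.
have [w XE] : exists w, (X :\ u) :\ v = [set w].
  apply/cards1P; move: X3.
  by rewrite (cardsD1 u) uX (cardsD1 v) !inE eq_sym uv vX !add1n => -[->].
have : w \in (X :\ u) :\ v by rewrite XE set11.
rewrite !inE => /and3P[wv wu wX].
have third z : z \in X -> z != u -> z != v -> z = w.
  by move=> zX zu zv; apply/set1P; rewrite -XE !inE zX zu zv.
wlog lt_vw : u v uX vX uv XE wu wv third / cdist u v < cdist u w.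
  move=> H; case: (ltnP (cdist u v) (cdist u w)) => [|lt_wv]; first exact: H.
  apply/visible_sym/H => //; rewrite 1?eq_sym //.
  - by rewrite -XE; apply/setP=> z; rewrite !inE andbCA.
  - by move=> z zX zv zu; apply: third.
  - move: lt_wv uv wu wv; rewrite -!val_eqE /=.
    have := cdistP u v; have := cdistP u w.
    by have := cdistP v u; have := cdistP v w; lia.
case: (leqP (2 * cdist u v) n) => [duv|duv].
  by apply: visible_arc => // z zX zu zv; rewrite (third z).
case: noapex; exists u; rewrite /apex uX; apply/subsetP=> z.
rewrite !inE => /andP[zu zX].
by have [->//|/(third z zX zu)->] := eqVneq z v; lia.
Qed.

(** * Counting *)

Lemma card_far u : #|far u| = n.-1./2.
Proof.
set s := traject (@ordS n) u n.
have s_uniq : uniq s.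
  by apply: (@map_uniq _ _ (cdist u)); rewrite cdist_traject ?iota_uniq.
have s_perm : perm_eq s (enum 'I_n).
  apply: uniq_perm; rewrite ?enum_uniq //.
  have sub_s : {subset s <= enum 'I_n} by move=> x _; rewrite mem_enum.
  case: (uniq_min_size s_uniq sub_s) => //.
  by rewrite size_traject size_enum_ord.
have -> : #|far u| = count (fun x => n < 2 * cdist u x) s.
  rewrite (permP s_perm) enumT cardE size_filter.
  by apply: eq_count => x; rewrite !inE.
rewrite -(count_map (cdist u) (fun k => n < 2 * k)) cdist_traject //.
(* The coordinates 0, ..., n./2 are at most half of n, the others exceed it. *)
have e : n = n./2.+1 + n.-1./2 by lia.
rewrite [X in iota 0 X]e iotaD count_cat (@eq_in_count _ _ pred0); last first.
  by move=> k; rewrite mem_iota /=; lia.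
rewrite [X in _ + X](@eq_in_count _ _ predT) ?count_pred0 ?count_predT ?size_iota //.
by move=> k; rewrite mem_iota /=; lia.
Qed.

(** Two apexes would be more than half the cycle apart in both directions, while
    the two distances add up to [n]. *)
Lemma apex_inj X u v : apex X u -> apex X v -> u = v.
Proof.
move=> /andP[uX ufar] /andP[vX vfar]; apply/eqP/negPn/negP=> uv.
have := subsetP ufar v; have := subsetP vfar u.
rewrite !inE uX vX uv eq_sym uv => /(_ isT) ? /(_ isT) ?.
by have := cdistC uv; lia.
Qed.

(** The pairs of an apex [u] and a two-element subset of [far u] correspond to
    the triples [u |: Y], injectively because the apex is unique. *)
Lemma card_with_apex :
  #|[set X : {set 'I_n} | (#|X| == 3) && [exists u, apex X u]]|
    = n * 'C(n.-1./2, 2).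
Proof.
pose P := [set q : 'I_n * {set 'I_n} | (q.2 \subset far q.1) && (#|q.2| == 2)].
have notin_far u Y : Y \subset far u -> u \notin Y.
  by move=> Yu; apply/negP=> /(subsetP Yu); rewrite inE cdistxx muln0.
have apexU u Y : Y \subset far u -> apex (u |: Y) u.
  by move=> Yu; rewrite /apex setU11 setU1K ?notin_far.
have -> : [set X : {set 'I_n} | (#|X| == 3) && [exists u, apex X u]]
          = [set q.1 |: q.2 | q in P].
  apply/setP=> X; rewrite inE; apply/andP/imsetP.
    case=> /eqP X3 /existsP[u /andP[uX ufar]]; exists (u, X :\ u); last first.
      by rewrite setD1K.
    by move: X3; rewrite inE ufar (cardsD1 u) uX add1n => -[->].
  case=> -[u Y]; rewrite inE => /andP[/= Yu /eqP Y2] ->; split.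
    by rewrite cardsU1 Y2 notin_far.
  by apply/existsP; exists u; apply: apexU.
rewrite card_in_imset; last first.
  move=> [u Y] [v Z]; rewrite !inE /= => /andP[Yu _] /andP[Zv _] e.
  have uv : u = v.
    by apply: apex_inj (apexU _ _ Yu) _; rewrite e; apply: apexU.
  move: Zv e; rewrite -uv => Zu e; congr (_, _).
  by rewrite -(setU1K (notin_far _ _ Yu)) e setU1K ?notin_far.
rewrite -sum1dep_card.
rewrite (eq_bigl (fun q : 'I_n * {set 'I_n} =>
  xpredT q.1 && ((q.2 \subset far q.1) && (#|q.2| == 2)))) //.
rewrite -(pair_big_dep xpredT
  (fun u Y => (Y \subset far u) && (#|Y| == 2)) (fun _ _ => 1)) /=.
rewrite (eq_bigr (fun=> 'C(n.-1./2, 2))) ?sum_nat_const ?card_ord // => u _.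
by rewrite sum1dep_card cards_draws card_far.
Qed.

Lemma num_mutual_visibility_le2 i : i <= 2 ->
  num_mutual_visibility_sets C i = 'C(n, i).
Proof.
move=> i2; rewrite -[n in RHS]card_ord -card_draws; apply: eq_card => X.
rewrite !inE; case: eqP => [Xi|]; rewrite ?andbF // andbT.
by apply/asboolP/mutual_visibility_le2; rewrite Xi.
Qed.

Lemma num_mutual_visibility3 :
  num_mutual_visibility_sets C 3 + n * 'C(n.-1./2, 2) = 'C(n, 3).
Proof.
rewrite -card_with_apex addnC -[n in RHS]card_ord -card_draws.
rewrite -(cardsID [set X : {set 'I_n} | [exists u, apex X u]]
  [set X : {set 'I_n} | #|X| == 3]).
congr (_ + _); apply: eq_card => X; rewrite !inE // andbC.
case: eqP => [X3|]; rewrite ?andbF // !andbT.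
apply/asboolP/idP => [/(mutual_visibility3 X3) H|H].
  by apply/existsP.
by apply/(mutual_visibility3 X3)=> /existsP; apply/negP.
Qed.

Lemma num_mutual_visibility_ge4 i : 4 <= i ->
  num_mutual_visibility_sets C i = 0.
Proof.
move=> i4; apply: eq_card0 => X; rewrite !inE; apply/negP=> /andP[/asboolP mvX].
by move/eqP=> Xi; have := mutual_visibility_lt4 mvX; rewrite Xi ltnNge i4.
Qed.

End Cycle.

(** * The polynomial *)

Lemma bin2_rat m : 'C(m, 2)%:R = m%:R * (m%:R - 1) / 2%:R :> rat.
Proof.
elim: m => [|m IH]; first by rewrite bin0n /= !mulr0n !mul0r.
by rewrite binS bin1 natrD IH -natr1; field.
Qed.

Lemma bin3_rat m :
  'C(m, 3)%:R = m%:R * (m%:R - 1) * (m%:R - 2%:R) / 6%:R :> rat.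
Proof.
elim: m => [|m IH]; first by rewrite bin0n /= !mulr0n !mul0r.
by rewrite binS natrD IH bin2_rat -natr1; field.
Qed.

Theorem theorem6 (n : nat) (hn : (3 <= n)%N) :
  visibility_poly (cycle_graph n) =
    1 + n%:R *: 'X + ('C(n, 2))%:R *: 'X^2 +
    (if odd n then n%:R * (n%:R ^+ 2 - 1) / 24%:R
     else (n%:R - 2%:R) * n%:R * (n%:R + 8%:R) / 24%:R) *: 'X^3.
Proof.
have r3 : (num_mutual_visibility_sets (cycle_graph n) 3)%:R
    = if odd n then n%:R * (n%:R ^+ 2 - 1) / 24%:R
      else (n%:R - 2%:R) * n%:R * (n%:R + 8%:R) / 24%:R :> rat.
  have /(congr1 (fun m => m%:R : rat)) := num_mutual_visibility3 hn.
  rewrite natrD natrM bin2_rat bin3_rat => /(canRL (addrK _)) ->.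
  (* Eliminating n for k makes both sides polynomials in k alone. *)
  set k := n.-1./2; have [nodd|neven] := boolP (odd n).
  - have -> : n%:R = 2%:R * k%:R + 1 :> rat.
      by rewrite -natrM natr1; congr _%:R; rewrite /k; lia.
    by field.
  - have -> : n%:R = 2%:R * k%:R + 2%:R :> rat.
      by rewrite -natrM -natrD; congr _%:R; rewrite /k; lia.
    by field.
rewrite /visibility_poly card_ord -(big_mkord predT
  (fun i => (num_mutual_visibility_sets (cycle_graph n) i)%:R *: 'X^i)).
rewrite (@big_cat_nat _ _ _ 4) //= [X in _ + X]big1_seq ?addr0; last first.
  move=> i /andP[_]; rewrite mem_index_iota => /andP[i4 _].
  by rewrite num_mutual_visibility_ge4 // scale0r.
rewrite !big_nat_recr //= big_nil add0r r3.
by rewrite !num_mutual_visibility_le2 // bin0 bin1 expr0 expr1 scale1r.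
Qed.
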